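(* Let $\Lambda$ be an algebra and $M$ a minimal extending brick in $\operatorname{mod}\Lambda$ with dimension vector $\mathbf{d}$. Then the orbit of $M$ under the action of $\operatorname{GL}(\mathbf{d})$ is open in $\operatorname{rep}(\Lambda,\mathbf{d})$.
   Context: $k$ is an algebraically closed field. $\Lambda$ is a finite-dimensional associative unital $k$-algebra, basic and connected, given as $\Lambda=kQ/I$ with $Q$ a finite connected quiver and $I$ an admissible ideal. Modules are left modules, viewed as representations of the bound quiver $(Q,I)$; $\operatorname{mod}\Lambda$ is the category of finitely generated ones. A brick is a module whose endomorphism algebra is a division algebra. A torsion class in $\operatorname{mod}\Lambda$ is a full subcategory closed under quotients and extensions. If $\mathcal T\subsetneq\mathcal T'$ are functorially finite torsion classes forming a covering relation in the poset of torsion classes of $\operatorname{mod}\Lambda$ ordered by inclusion, then there is a unique brick $B\in\mathcal T'$ such that: (1) $\operatorname{Hom}_\Lambda(T,B)=0$ for all $T\in\mathcal T$; (2) every proper quotient of $B$ lies in $\mathcal T$; (3) for every non-split short exact sequence $0\to B\to X\to T\to 0$ with $T\in\mathcal T$, one has $X\in\mathcal T$. Such a $B$ is called a minimal extending brick (for $\mathcal T$). For a dimension vector $\mathbf d=(d_x)_{x\in Q_0}\in\mathbb Z_{\ge0}^{Q_0}$, $\operatorname{rep}(\Lambda,\mathbf d)$ is the closed subvariety of the affine space $\prod_{\alpha\in Q_1}\mathrm{Mat}_{d_{e(\alpha)}\times d_{s(\alpha)}}(k)$ (where $\alpha$ goes from $s(\alpha)$ to $e(\alpha)$) whose points are the representations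 annihilated by $I$, with the Zariski topology. $\operatorname{GL}(\mathbf d)=\prod_{x\in Q_0}\operatorname{GL}_{d_x}(k)$ acts by conjugation (change of basis), and its orbits correspond to isomorphism classes of modules of dimension vector $\mathbf d$. *)

(* Defs.v *)
From HB Require Import structures.
From mathcomp Require Import all_boot all_order all_algebra.
From mathcomp.multinomials Require Import freeg mpoly.

Set Implicit Arguments.
Unset Strict Implicit.
Unset Printing Implicit Defensive.

Import GRing.Theory.
Local Open Scope ring_scope.

(** * Quivers, path algebras and admissible ideals *)

Record quiver := Quiver {
  vertex : finType;
  arrow : finType;
  src : arrow -> vertex;
  tgt : arrow -> vertex
}.

Definition adjacent (Q : quiver) : rel (vertex Q) := fun x y =>
  [exists a : arrow Q, ((src a == x) && (tgt a == y))
                    || ((src a == y) && (tgt a == x))].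

Definition connected_quiver (Q : quiver) : Prop :=
  (0 < #|vertex Q|)%N /\ forall x y : vertex Q, connect (@adjacent Q) x y.

Fixpoint is_walk (Q : quiver) (x : vertex Q) (s : seq (arrow Q)) : bool :=
  if s is a :: s' then (src a == x) && is_walk (tgt a) s' else true.

(** The pair [(x, [:: a1; ...; an])] is the path that starts at [x] and runs
    through [a1] first and [an] last; [(x, [::])] is the trivial path at [x]. *)
Record qpath (Q : quiver) := QPath {
  qpath_val : vertex Q * seq (arrow Q);
  _ : is_walk qpath_val.1 qpath_val.2
}.

HB.instance Definition _ (Q : quiver) := [isSub for @qpath_val Q].
HB.instance Definition _ (Q : quiver) := [Choice of qpath Q by <:].

Definition pstart (Q : quiver) (p : qpath Q) : vertex Q := (val p).1.
Definition parrows (Q : quiver) (p : qpath Q) : seq (arrow Q) := (val p).2.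
Definition pend (Q : quiver) (p : qpath Q) : vertex Q :=
  last (pstart p) (map (@tgt Q) (parrows p)).
Definition plength (Q : quiver) (p : qpath Q) : nat := size (parrows p).

(** The underlying vector space of [kQ]: formal [k]-linear combinations of
    paths. *)
Notation path_alg k Q := {freeg (qpath Q) / k}.

Section PathAlgebra.
Variables (k : closedFieldType) (Q : quiver).

(** Paths compose like functions: [path_mul p q] is "[q] first, then [p]", so
    that representations of [Q] are left [kQ]-modules. *)
Definition path_mul (p q : qpath Q) : path_alg k Q :=
  if pend q == pstart p then
    if insub (pstart q, parrows q ++ parrows p) is Some r then << r >> else 0
  else 0.

Definition pa_mul (f g : path_alg k Q) : path_alg k Q :=
  \sum_(p <- dom f) \sum_(q <- dom g) (coeff p f * coeff q g) *: path_mul p q.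

Definition two_sided_ideal (I : path_alg k Q -> Prop) : Prop :=
  [/\ I 0,
      (forall f g, I f -> I g -> I (f + g)),
      (forall f g, I g -> I (pa_mul f g)) &
      (forall f g, I f -> I (pa_mul f g))].

(** [R_Q ^ m], where [R_Q] is the ideal generated by the arrows: the span of
    the paths of length at least [m]. *)
Definition arrow_ideal_pow (m : nat) (f : path_alg k Q) : Prop :=
  forall p, p \in dom f -> (m <= plength p)%N.

Definition admissible (I : path_alg k Q -> Prop) : Prop :=
  [/\ two_sided_ideal I,
      (exists2 m, (2 <= m)%N & forall f, arrow_ideal_pow m f -> I f) &
      (forall f, I f -> arrow_ideal_pow 2 f)].

End PathAlgebra.

(** * The representation variety *)

Section RepVariety.
Variables (k : closedFieldType) (Q : quiver) (d : vertex Q -> nat).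

(** The affine space of representations of [Q] with dimension vector [d],
    before relations are imposed. *)
Definition rep_space : Type :=
  forall a : arrow Q, 'M[k]_(d (tgt a), d (src a)).

(** The left [kQ]-module attached to [V] lives on [\bigoplus_x k^(d x)]: a
    trivial path acts as the projection onto the summand of its vertex. *)
Definition rep_vect : Type := forall x : vertex Q, 'cV[k]_(d x).

Definition supp_at (x : vertex Q) (w : 'cV[k]_(d x)) : rep_vect :=
  @dfwith _ (fun y => 'cV[k]_(d y)) (fun y => 0) x w.

Definition arrow_act (V : rep_space) (v : rep_vect) (a : arrow Q) : rep_vect :=
  supp_at (V a *m v (src a)).

Definition path_act (V : rep_space) (p : qpath Q) (v : rep_vect) : rep_vect :=
  foldl (arrow_act V) (supp_at (v (pstart p))) (parrows p).

Definition pa_act (V : rep_space) (f : path_alg k Q) (v : rep_vect) : rep_vect :=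
  fun x => \sum_(p <- dom f) coeff p f *: path_act V p v x.

Definition rep_variety (I : path_alg k Q -> Prop) (V : rep_space) : Prop :=
  forall f, I f -> forall v x, pa_act V f v x = 0.

(** The coordinate functions on [rep_space] are indexed by the entries of the
    matrices. *)
Definition coord_index : finType :=
  {a : arrow Q & ('I_(d (tgt a)) * 'I_(d (src a)))%type}.

Definition coord (V : rep_space) (c : coord_index) : k :=
  V (tag c) (tagged c).1 (tagged c).2.

Definition zariski_closed (C : rep_space -> Prop) : Prop :=
  exists S : {mpoly k[#|coord_index|]} -> Prop,
    forall V, C V <-> forall P, S P -> P.@[fun i => coord V (enum_val i)] = 0.

Definition zariski_open (U : rep_space -> Prop) : Prop :=
  zariski_closed (fun V => ~ U V).

Definition open_in (X U : rep_space -> Prop) : Prop :=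
  exists2 O, zariski_open O & forall V, U V <-> X V /\ O V.

Definition GL_orbit (V W : rep_space) : Prop :=
  exists2 g : forall x, 'M[k]_(d x),
    (forall x, g x \in unitmx) &
    (forall a, W a = g (tgt a) *m V a *m invmx (g (src a))).

End RepVariety.

(** * Modules over a bound quiver algebra *)

Section Modules.
Variables (k : closedFieldType) (Q : quiver) (I : path_alg k Q -> Prop).

(** Finitely generated left [kQ/I]-modules, as representations of [(Q, I)] on
    the coordinate spaces [k^(d x)]. *)
Record module := Module {
  dim_vect : vertex Q -> nat;
  mod_rep : rep_space k dim_vect;
  _ : rep_variety I mod_rep
}.

Record hom (M N : module) := Hom {
  hom_mx :> forall x, 'M[k]_(dim_vect N x, dim_vect M x);
  _ : forall a, hom_mx (tgt a) *m mod_rep M a = mod_rep N a *m hom_mx (src a)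
}.

Definition mono (M N : module) (f : hom M N) : Prop :=
  forall x (v : 'cV[k]_(dim_vect M x)), f x *m v = 0 -> v = 0.

Definition epi (M N : module) (f : hom M N) : Prop :=
  forall x (w : 'cV[k]_(dim_vect N x)), exists v, f x *m v = w.

Definition short_exact (L M N : module) (f : hom L M) (g : hom M N) : Prop :=
  [/\ mono f, epi g &
      forall x (v : 'cV[k]_(dim_vect M x)),
        g x *m v = 0 <-> exists u, f x *m u = v].

Definition split_epi (M N : module) (g : hom M N) : Prop :=
  exists h : hom N M, forall x, g x *m h x = 1%:M.

Definition brick (B : module) : Prop :=
  (exists x, (1%:M : 'M[k]_(dim_vect B x)) != 0) /\
  forall f : hom B B, (exists x, f x != 0) ->
    exists g : hom B B,
      forall x, f x *m g x = 1%:M /\ g x *m f x = 1%:M.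

(** Full subcategories are given by their classes of objects. *)
Definition subcat := module -> Prop.

(** The first clause excludes the empty class; closure under isomorphism is
    part of closure under quotients. *)
Definition torsion_class (T : subcat) : Prop :=
  [/\ (exists M, T M),
      (forall (M N : module) (f : hom M N), epi f -> T M -> T N) &
      (forall (L M N : module) (f : hom L M) (g : hom M N),
         short_exact f g -> T L -> T N -> T M)].

Definition contravariantly_finite (T : subcat) : Prop :=
  forall M, exists X (f : hom X M), T X /\
    forall Y (g : hom Y M), T Y ->
      exists h : hom Y X, forall x, g x = f x *m h x.

Definition covariantly_finite (T : subcat) : Prop :=
  forall M, exists X (f : hom M X), T X /\
    forall Y (g : hom M Y), T Y ->
      exists h : hom X Y, forall x, g x = h x *m f x.

Definition functorially_finite (T : subcat) : Prop :=
  contravariantly_finite T /\ covariantly_finite T.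

Definition subcat_le (S T : subcat) : Prop := forall M, S M -> T M.

Definition subcat_lt (S T : subcat) : Prop :=
  subcat_le S T /\ ~ subcat_le T S.

Definition torsion_cover (T T' : subcat) : Prop :=
  [/\ torsion_class T, torsion_class T', subcat_lt T T' &
      forall S, torsion_class S -> ~ (subcat_lt T S /\ subcat_lt S T')].

Definition minimal_extending_brick_for (T : subcat) (B : module) : Prop :=
  exists T' : subcat,
    [/\ functorially_finite T, functorially_finite T', torsion_cover T T',
        brick B & T' B] /\
    [/\ (forall (M : module) (f : hom M B), T M -> forall x, f x = 0),
        (forall (N : module) (f : hom B N), epi f -> ~ mono f -> T N) &
        (forall (X M : module) (f : hom B X) (g : hom X M),
           short_exact f g -> ~ split_epi g -> T M -> T X)].

Definition minimal_extending_brick (B : module) : Prop :=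
  exists T, minimal_extending_brick_for T B.

End Modules.

(* Main.v *)
Require Import Defs.
From mathcomp Require Import all_boot all_order all_algebra.
From mathcomp.multinomials Require Import freeg mpoly.
From Stdlib Require Import Classical_Prop.

(** Let [T < T'] be the cover for which [M] is the minimal extending brick. Since
    [T] is covariantly finite, it has a weakly initial pointed object [C], so
    [Hom(X, V) = 0] for all [X] in [T] exactly when [Hom(C, V) = 0]; the latter is
    the injectivity of a linear system with coefficients polynomial in [V], hence
    an open condition [O]. It holds at [M], and it remains to see that every
    module [N] in [O] with the dimension vector of [M] is isomorphic to [M].

    For [T'] take a weakly initial pointed object [C'] of minimal dimension: it is
    Ext-projective in [T']. In a presentation [P1 -> P0 -> C' -> 0] with [P0], [P1]
    free and [P1] covering the kernel minimally, [Hom(P0, M) -> Hom(P1, M)] is then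
    onto, with kernel [Hom(C', M) <> 0]. As the dimensions of [Hom(Pi, N)] depend
    only on the dimension vector of [N], it follows that [Hom(C', N) <> 0]. The
    image [Y] of a nonzero map [C' -> N] lies in [T'], and [Hom(T, Y) = 0]. If
    [Hom(M, Y)] vanished, then [{X in T' | Hom(X, Y) = 0}] would be a torsion class
    strictly between [T] and [T']. So there is a nonzero map [M -> N]; it is
    injective, because proper quotients of [M] lie in [T], and therefore bijective. *)

Set Implicit Arguments.
Unset Strict Implicit.
Unset Printing Implicit Defensive.

(* [Defs] again, because [vector] declares its own [hom]. *)
Import GRing.Theory Defs.

(** * Extremal elements of sets of natural numbers *)

Lemma ex_nat_min (P : nat -> Prop) :
  (exists n, P n) -> exists n, P n /\ forall m, P m -> n <= m.
Proof.
case=> n; elim/ltn_ind: n => n IH Pn.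
have [[m [ltmn Pm]]|nPm] := classic (exists m, m < n /\ P m); first exact: IH Pm.
exists n; split=> // m Pm; rewrite leqNgt; apply/negP => ltmn.
by case: nPm; exists m.
Qed.

Lemma ex_nat_max (P : nat -> Prop) b :
  (exists n, P n) -> (forall n, P n -> n <= b) ->
  exists n, P n /\ forall m, P m -> m <= n.
Proof.
move=> [n0 Pn0] leb.
have [|j [[n [Pn ->]] minj]] := @ex_nat_min (fun j => exists n, P n /\ j = b - n).
  by exists (b - n0), n0.
exists n; split=> // m Pm; have /minj : exists m', P m' /\ b - m = b - m'.
  by exists m.
by rewrite leq_sub2lE // leb.
Qed.

(** * Linear algebra on column vectors *)

Section LinearAlgebra.
Local Open Scope ring_scope.
Variable k : fieldType.

Lemma mulmx_cVP m n (A B : 'M[k]_(m, n)) :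
  (forall v : 'cV_n, A *m v = B *m v) -> A = B.
Proof.
move=> eqAB; apply/matrixP => i j.
by have /matrixP/(_ i 0) := eqAB (delta_mx j 0); rewrite -!colE !mxE.
Qed.

Lemma surj_mx_rinv m n (A : 'M[k]_(m, n)) :
  (forall w : 'cV_m, exists v, A *m v = w) -> exists B, A *m B = 1%:M.
Proof.
move=> surjA.
have [f fP] := fin_all_exists (fun i : 'I_m => surjA (delta_mx i 0)).
exists (\matrix_(i, j) f j i 0); apply/mulmx_cVP => v; rewrite mul1mx -mulmxA.
rewrite [v in RHS]matrix_sum_delta; under eq_bigr do rewrite big_ord1.
have -> : \matrix_(i, j) f j i 0 *m v = \sum_j v j 0 *: f j.
  apply/colP => i; rewrite !mxE summxE.
  by apply: eq_bigr => j _; rewrite !mxE mulrC.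
by rewrite mulmx_sumr; apply: eq_bigr => j _; rewrite -scalemxAr fP.
Qed.

Lemma inj_mx_linv m n (A : 'M[k]_(m, n)) :
  (forall v : 'cV_n, A *m v = 0 -> v = 0) -> exists B, B *m A = 1%:M.
Proof.
move=> injA; have : row_free A^T.
  apply: inj_row_free => v /(congr1 trmx); rewrite trmx_mul trmxK trmx0.
  by move/injA/(congr1 trmx); rewrite trmxK trmx0.
case/row_freeP => B BP; exists B^T; apply: trmx_inj.
by rewrite trmx_mul trmxK BP trmx1.
Qed.

Lemma factor_mx m n p (f : 'M[k]_(m, n)) (F : 'M_(m, p)) :
  (forall c : 'cV_p, exists u, f *m u = F *m c) -> exists E, f *m E = F.
Proof.
move=> fF; have [u uP] := fin_all_exists (fun j : 'I_p => fF (delta_mx j 0)).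
exists (\matrix_(i, j) u j i 0); apply/matrixP => i j.
have /colP/(_ i) := uP j; rewrite -colE [in RHS]mxE => <-.
by rewrite !mxE; apply: eq_bigr => l _; rewrite mxE.
Qed.

Lemma surj_mx_leq m n (A : 'M[k]_(m, n)) :
  (forall w : 'cV_m, exists v, A *m v = w) -> (m <= n)%N.
Proof.
case/surj_mx_rinv => B AB; have : row_free A by apply/row_freeP; exists B.
by move/eqP <-; exact: rank_leq_col.
Qed.

Lemma inj_mx_leq m n (A : 'M[k]_(m, n)) :
  (forall v : 'cV_n, A *m v = 0 -> v = 0) -> (n <= m)%N.
Proof.
case/inj_mx_linv => B BA; have : row_full A by apply/row_fullP; exists B.
by move/eqP <-; exact: rank_leq_row.
Qed.

Lemma surj_mx_inj m n (A : 'M[k]_(m, n)) : m = n ->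
  (forall w : 'cV_m, exists v, A *m v = w) ->
  forall v : 'cV_n, A *m v = 0 -> v = 0.
Proof.
move=> eqmn; case: _ / eqmn in A * => /surj_mx_rinv [B /mulmx1C BA] v Av.
by rewrite -[v]mul1mx -BA -mulmxA Av mulmx0.
Qed.

Lemma inj_mx_surj m n (A : 'M[k]_(m, n)) : m = n ->
  (forall v : 'cV_n, A *m v = 0 -> v = 0) ->
  (forall w : 'cV_m, exists v, A *m v = w).
Proof.
move=> eqmn; case: _ / eqmn in A * => /inj_mx_linv [B /mulmx1C AB] w.
by exists (B *m w); rewrite mulmxA AB mul1mx.
Qed.

Definition is_subspace n (U : 'cV[k]_n -> Prop) :=
  [/\ U 0, (forall u v, U u -> U v -> U (u + v)) &
      (forall c u, U u -> U (c *: u))].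

(** Among the matrices whose rows, transposed, span a part of [U], one of maximal rank works:
    adjoining a vector of [U] as a further row cannot raise the rank. *)
Lemma subspace_mx n (U : 'cV[k]_n -> Prop) : is_subspace U ->
  exists A : 'M_n, forall v, U v <-> (v^T <= A)%MS.
Proof.
case=> U0 UD UZ.
pose P r := exists A : 'M[k]_n, (forall c : 'rV_n, U (c *m A)^T) /\ \rank A = r.
have [||r [[A [UA <-]] maxA]] := @ex_nat_max P n.
- by exists 0%N, 0; split; [move=> c; rewrite mulmx0 trmx0 | rewrite mxrank0].
- by move=> _ [A [_ <-]]; exact: rank_leq_col.
exists A => v; split=> [Uv|]; last first.
  by case/submxP => c vE; rewrite -[v]trmxK vE.
have /maxA : P (\rank (A + v^T)%MS).
  exists (A + v^T)%MS; split=> // c.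
  have /sub_addsmxP[[u1 u2] /= ->] : (c *m (A + v^T)%MS <= A + v^T)%MS.
    exact: submxMl.
  rewrite [u2]mx11_scalar mul_scalar_mx linearD linearZ /= trmxK.
  by apply: UD => //; apply: UZ.
rewrite (geq_leqif (mxrank_leqif_sup (addsmxSl A v^T))).
by apply: submx_trans; exact: addsmxSr.
Qed.

(** Coordinates on the quotient by [U], from a rank factorization of a cokernel matrix; [D] picks
    representatives. *)
Lemma subspace_kernel n (U : 'cV[k]_n -> Prop) : is_subspace U ->
  exists r (C : 'M[k]_(r, n)), (exists D, C *m D = 1%:M) /\
    forall v, C *m v = 0 <-> U v.
Proof.
case/subspace_mx => A AP; exists (\rank (cokermx A)), (col_base (cokermx A))^T.
split.
  have /row_fullP[D DP] := col_base_full (cokermx A).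
  by exists D^T; rewrite -trmx_mul DP trmx1.
move=> v; rewrite AP submxE; split=> [|/eqP].
  move/(congr1 trmx); rewrite trmx_mul trmxK trmx0 => v0.
  by rewrite -{1}[cokermx A]mulmx_base mulmxA v0 mul0mx.
rewrite -{1}[cokermx A]mulmx_base mulmxA => v0; apply: trmx_inj.
rewrite trmx_mul trmxK trmx0; apply: (row_free_inj (row_base_free (cokermx A))).
by rewrite v0 mul0mx.
Qed.

Lemma subspace_image n (U : 'cV[k]_n -> Prop) : is_subspace U ->
  exists r (A : 'M[k]_(n, r)), (exists B, B *m A = 1%:M) /\
    forall v, U v <-> exists c, A *m c = v.
Proof.
case/subspace_mx => A AP; exists (\rank A), (row_base A)^T; split.
  have /row_freeP[D DP] := row_base_free A.
  by exists D^T; rewrite -trmx_mul DP trmx1.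
move=> v; rewrite AP -(eq_row_base A); split.
  by case/submxP => c vE; exists c^T; rewrite -trmx_mul -vE trmxK.
by case=> c <-; rewrite trmx_mul trmxK submxMl.
Qed.

End LinearAlgebra.

(** * Representations, intertwiners and nilpotency of the arrows *)

Section Representations.
Local Open Scope ring_scope.
Variables (k : closedFieldType) (Q : quiver).
Implicit Types (d e : vertex Q -> nat) (x y : vertex Q) (a : arrow Q).

(** The condition in [hom], for arbitrary points of [rep_space], before any relations are known to
    hold. *)
Definition intertwines d e (V : rep_space k d) (W : rep_space k e)
    (f : forall x, 'M[k]_(e x, d x)) :=
  forall a, f (tgt a) *m V a = W a *m f (src a).

Lemma supp_at_in d x (w : 'cV[k]_(d x)) : supp_at w x = w.
Proof. exact: dfwith_in. Qed.

Lemma supp_at_out d x y (w : 'cV[k]_(d x)) : x != y -> supp_at w y = 0.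
Proof. by move=> neq; rewrite /supp_at dfwith_out. Qed.

Lemma mulmx_supp_at d e (f : forall x, 'M[k]_(e x, d x)) x (w : 'cV[k]_(d x)) y :
  f y *m supp_at w y = supp_at (f x *m w) y.
Proof.
have [<-|neq] := eqVneq x y; first by rewrite !supp_at_in.
by rewrite !supp_at_out // mulmx0.
Qed.

Lemma supp_at0 d x y : supp_at (0 : 'cV[k]_(d x)) y = 0.
Proof.
by have [<-|neq] := eqVneq x y; rewrite ?supp_at_in // supp_at_out.
Qed.

Lemma supp_atD d x (u w : 'cV[k]_(d x)) y :
  supp_at (u + w) y = supp_at u y + supp_at w y.
Proof.
have [<-|neq] := eqVneq x y; first by rewrite !supp_at_in.
by rewrite !supp_at_out // addr0.
Qed.

Lemma supp_atZ d x c (u : 'cV[k]_(d x)) y : supp_at (c *: u) y = c *: supp_at u y.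
Proof.
have [<-|neq] := eqVneq x y; first by rewrite !supp_at_in.
by rewrite !supp_at_out // scaler0.
Qed.

Lemma supp_at_sum d x (J : finType) (u : J -> 'cV[k]_(d x)) y :
  supp_at (\sum_j u j) y = \sum_j supp_at (u j) y.
Proof.
have [<-|neq] := eqVneq x y.
  by rewrite supp_at_in; apply: eq_bigr => j _; rewrite supp_at_in.
by rewrite supp_at_out // big1 // => j _; rewrite supp_at_out.
Qed.

Section Intertwiner.
Variables (d e : vertex Q -> nat) (V : rep_space k d) (W : rep_space k e).
Variable f : forall x, 'M[k]_(e x, d x).
Hypothesis fP : intertwines V W f.

Lemma intertwines_foldl s (v : rep_vect k d) (w : rep_vect k e) :
    (forall x, f x *m v x = w x) ->
  forall x, f x *m foldl (arrow_act V) v s x = foldl (arrow_act W) w s x.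
Proof.
elim: s v w => [|a s IH] v w //= vw; apply: IH => x.
by rewrite mulmx_supp_at mulmxA fP -mulmxA vw.
Qed.

Lemma intertwines_pa_act g (v : rep_vect k d) (w : rep_vect k e) :
    (forall x, f x *m v x = w x) ->
  forall x, f x *m pa_act V g v x = pa_act W g w x.
Proof.
move=> vw x; rewrite mulmx_sumr; apply: eq_bigr => p _.
rewrite -scalemxAr; congr (_ *: _); apply: intertwines_foldl => y.
by rewrite mulmx_supp_at vw.
Qed.

(** An intertwiner commutes with the action of the path algebra, so relations are inherited by
    subrepresentations and likewise by quotients; this makes modules out of the representations
    constructed below. *)
Lemma rep_variety_mono I : (forall x (v : 'cV_(d x)), f x *m v = 0 -> v = 0) ->
  rep_variety I W -> rep_variety I V.
Proof.
move=> injf WI g Ig v x; apply: injf.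
by rewrite (@intertwines_pa_act _ _ (fun x => f x *m v x)) // WI.
Qed.

Lemma rep_variety_epi I : (forall x (w : 'cV_(e x)), exists v, f x *m v = w) ->
  rep_variety I V -> rep_variety I W.
Proof.
move=> surjf VI g Ig w x.
have [v vw] := fin_all_exists (fun x => surjf x (w x)).
by rewrite -(intertwines_pa_act g vw) VI // mulmx0.
Qed.

End Intertwiner.

Section Nilpotency.
Variables (d : vertex Q -> nat) (V : rep_space k d).

Lemma foldl_arrow_act0 s (v : rep_vect k d) : (forall x, v x = 0) ->
  forall x, foldl (arrow_act V) v s x = 0.
Proof.
elim: s v => [|a s IH] v //= v0; apply: IH => x.
by rewrite /arrow_act v0 mulmx0 supp_at0.
Qed.

(** Elements of [rep_vect] are functions compared pointwise; this stands in for functional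
    extensionality. *)
Lemma foldl_arrow_act_ext s (v w : rep_vect k d) : (forall x, v x = w x) ->
  forall x, foldl (arrow_act V) v s x = foldl (arrow_act V) w s x.
Proof.
elim: s v w => [|a s IH] v w //= vw; apply: IH => x.
by rewrite /arrow_act vw.
Qed.

(** An arrow reads only the component at its source, so the first arrow that fails to compose kills
    the vector. *)
Lemma foldl_arrow_act_nonwalk s x (w : 'cV[k]_(d x)) : ~~ is_walk x s ->
  forall y, foldl (arrow_act V) (supp_at w) s y = 0.
Proof.
elim: s x w => [|a s IH] x w //= nwalk y.
have [eqx|neq] := eqVneq (src a) x; last first.
  apply: foldl_arrow_act0 => z; rewrite /arrow_act (supp_at_out w) 1?eq_sym //.
  by rewrite mulmx0 supp_at0.
by apply: IH; move: nwalk; rewrite eqx eqxx.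
Qed.

Lemma foldl_arrow_act_bigsum (J : finType) s (u : J -> rep_vect k d) y :
  foldl (arrow_act V) (fun x => \sum_j u j x) s y =
    \sum_j foldl (arrow_act V) (u j) s y.
Proof.
elim: s u y => [|a s IH] u y //=; rewrite -IH.
by apply: foldl_arrow_act_ext => x; rewrite /arrow_act mulmx_sumr supp_at_sum.
Qed.

Lemma foldl_arrow_act_sum s (v : rep_vect k d) y :
  foldl (arrow_act V) v s y = \sum_x foldl (arrow_act V) (supp_at (v x)) s y.
Proof.
rewrite -foldl_arrow_act_bigsum; apply: foldl_arrow_act_ext => x.
by rewrite (bigD1 x) //= supp_at_in big1 ?addr0 // => z /supp_at_out->.
Qed.

(** Split [v] into its components at the vertices: from each vertex, [s] is either no walk or a path
    of length at least [m], which lies in [I]. *)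
Lemma rep_nilpotent I m : (forall f, arrow_ideal_pow m f -> I f) ->
  rep_variety I V -> forall s (v : rep_vect k d) y, (m <= size s)%N ->
  foldl (arrow_act V) v s y = 0.
Proof.
move=> Im VI s v y les; rewrite foldl_arrow_act_sum big1 // => x _.
have [walk|] := boolP (is_walk x s); last by move/foldl_arrow_act_nonwalk->.
pose p : qpath Q := @QPath Q (x, s) walk.
have /VI/(_ v y) : I << p >>.
  by apply: Im => q; rewrite domU1 inE => /eqP->.
by rewrite /pa_act domU1 big_seq1 coeffU eqxx mulr1 scale1r.
Qed.

End Nilpotency.
End Representations.

(** * Submodules, quotients, direct sums and images *)

Section ModuleTheory.
Local Open Scope ring_scope.
Variables (k : closedFieldType) (Q : quiver) (I : path_alg k Q -> Prop).
Implicit Types (L M N : module I) (x y : vertex Q) (a : arrow Q).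

Lemma hom_intertwines M N (f : hom M N) : intertwines (mod_rep M) (mod_rep N) f.
Proof. by case: f. Qed.

Lemma mod_rep_variety M : rep_variety I (mod_rep M).
Proof. by case: M. Qed.

Lemma hom_mulmx M N (f : hom M N) a (v : 'cV_(dim_vect M (src a))) :
  f (tgt a) *m (mod_rep M a *m v) = mod_rep N a *m (f (src a) *m v).
Proof. by rewrite mulmxA hom_intertwines mulmxA. Qed.

Definition idhom M : hom M M.
Proof. by exists (fun=> 1%:M) => a; rewrite mul1mx mulmx1. Defined.

Definition comp_hom L M N (g : hom M N) (f : hom L M) : hom L N.
Proof.
exists (fun x => g x *m f x) => a.
by rewrite -mulmxA hom_intertwines mulmxA hom_intertwines mulmxA.
Defined.

Definition lincomb_hom M N (c : k) (f g : hom M N) : hom M N.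
Proof.
exists (fun x => c *: f x + g x) => a.
by rewrite mulmxDl mulmxDr -scalemxAl -scalemxAr !hom_intertwines.
Defined.

Definition zero_hom M N : hom M N.
Proof. by exists (fun=> 0) => a; rewrite mul0mx mulmx0. Defined.

Definition submodule M (U : forall x, 'cV[k]_(dim_vect M x) -> Prop) :=
  (forall x, is_subspace (@U x)) /\
  (forall a u, U (src a) u -> U (tgt a) (mod_rep M a *m u)).

(** Modules live on coordinate spaces, so the submodule is transported there: the columns of [A x]
    are a basis of [U x], and [B x] reads off coordinates. *)
Lemma ex_submodule M U : submodule U ->
  exists L (f : hom L M), mono f /\
    forall x v, U x v <-> exists u, f x *m u = v.
Proof.
case=> Usub Ustab.
have [r rP] := fin_all_exists (fun x => subspace_image (Usub x)).
have [A AP] := fin_all_exists rP.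
have [B BP] := fin_all_exists (fun x => (AP x).1).
have {}AP x := (AP x).2.
pose V : rep_space k r := fun a => B (tgt a) *m mod_rep M a *m A (src a).
have AV : intertwines V (mod_rep M) A.
  move=> a; apply: mulmx_cVP => v.
  have /Ustab/AP[u uP] : U (src a) (A (src a) *m v) by apply/AP; exists v.
  by rewrite /V -!mulmxA -uP (mulmxA (B _)) BP mul1mx.
have injA x (v : 'cV_(r x)) : A x *m v = 0 -> v = 0.
  by move=> v0; rewrite -[v]mul1mx -(BP x) -mulmxA v0 mulmx0.
pose L := Module (rep_variety_mono AV injA (@mod_rep_variety M)).
by exists L, (@Hom _ _ _ L M A AV).
Qed.

Lemma ex_quotient M U : submodule U ->
  exists N (q : hom M N), epi q /\ forall x v, q x *m v = 0 <-> U x v.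
Proof.
case=> Usub Ustab.
have [r rP] := fin_all_exists (fun x => subspace_kernel (Usub x)).
have [C CP] := fin_all_exists rP.
have [D DP] := fin_all_exists (fun x => (CP x).1).
have {}CP x := (CP x).2.
pose W : rep_space k r := fun a => C (tgt a) *m mod_rep M a *m D (src a).
have CW : intertwines (mod_rep M) W C.
  move=> a; apply: mulmx_cVP => v; rewrite /W -!mulmxA.
  have /Ustab/CP : U (src a) (v - D (src a) *m (C (src a) *m v)).
    by apply/CP; rewrite mulmxBr (mulmxA (C _) (D _)) DP mul1mx subrr.
  by rewrite !mulmxBr => /subr0_eq.
have surjC x (w : 'cV_(r x)) : exists v, C x *m v = w.
  by exists (D x *m w); rewrite mulmxA DP mul1mx.
pose N := Module (rep_variety_epi CW surjC (@mod_rep_variety M)).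
by exists N, (@Hom _ _ _ M N C CW).
Qed.

Lemma ex_direct_sum M N : exists S (i1 : hom M S) (i2 : hom N S)
    (p1 : hom S M) (p2 : hom S N),
  [/\ forall x, p1 x *m i1 x = 1%:M, forall x, p2 x *m i2 x = 1%:M,
      forall x, p1 x *m i2 x = 0, forall x, p2 x *m i1 x = 0 &
      forall x, i1 x *m p1 x + i2 x *m p2 x = 1%:M].
Proof.
pose d x := (dim_vect M x + dim_vect N x)%N.
pose V : rep_space k d := fun a => block_mx (mod_rep M a) 0 0 (mod_rep N a).
have p1P : intertwines V (mod_rep M) (fun x => row_mx 1%:M 0).
  move=> a; rewrite mul_row_block mul_mx_row.
  by rewrite !mul1mx !mulmx1 !mul0mx !mulmx0 !addr0.
have p2P : intertwines V (mod_rep N) (fun x => row_mx 0 1%:M).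
  move=> a; rewrite mul_row_block mul_mx_row.
  by rewrite !mul1mx !mulmx1 !mul0mx !mulmx0 !add0r.
have i1P : intertwines (mod_rep M) V (fun x => col_mx 1%:M 0).
  move=> a; rewrite mul_block_col mul_col_mx.
  by rewrite !mul1mx !mulmx1 !mul0mx !mulmx0 !addr0.
have i2P : intertwines (mod_rep N) V (fun x => col_mx 0 1%:M).
  move=> a; rewrite mul_block_col mul_col_mx.
  by rewrite !mul1mx !mulmx1 !mul0mx !mulmx0 !add0r.
have VI : rep_variety I V.
  (* The two projections carry the action of [f] into [M] and [N], where it vanishes. *)
  move=> f If v x; rewrite -[LHS]vsubmxK.
  have /(_ x) := @intertwines_pa_act _ _ _ _ _ _ _ p1P f v _ (fun x => erefl).
  have /(_ x) := @intertwines_pa_act _ _ _ _ _ _ _ p2P f v _ (fun x => erefl).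
  rewrite !mod_rep_variety // -(vsubmxK (pa_act V f v x)) !mul_row_col.
  rewrite !mul1mx !mul0mx add0r addr0 !col_mxKu !col_mxKd => -> ->.
  exact: col_mx0.
pose S := Module VI.
exists S, (@Hom _ _ _ M S _ i1P), (@Hom _ _ _ N S _ i2P).
exists (@Hom _ _ _ S M _ p1P), (@Hom _ _ _ S N _ p2P).
split=> x /=; rewrite ?mul_row_col ?mul1mx ?mul0mx ?mulmx0 ?addr0 ?add0r //.
rewrite !mul_col_mx !mul1mx !mul0mx add_col_mx add0r addr0.
by rewrite -block_mxEv -scalar_mx_block.
Qed.

(** The vertexwise linear section [D] of [q] may fail to intertwine, but [g D] does intertwine
    because [g] kills the kernel of [q]. *)
Lemma hom_lift M N Y (q : hom M N) (g : hom M Y) : epi q ->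
    (forall x (v : 'cV_(dim_vect M x)), q x *m v = 0 -> g x *m v = 0) ->
  exists h : hom N Y, forall x, h x *m q x = g x.
Proof.
move=> epiq qg.
have [D DP] := fin_all_exists (fun x => surj_mx_rinv (epiq x)).
pose h x := g x *m D x.
have hq x : h x *m q x = g x.
  apply: mulmx_cVP => v; apply/eqP; rewrite eq_sym -subr_eq0 -!mulmxA -mulmxBr.
  by rewrite qg // mulmxBr !mulmxA DP mul1mx subrr.
clearbody h.
have hP : intertwines (mod_rep N) (mod_rep Y) h.
  move=> a; apply: mulmx_cVP => w; have [v <-] := epiq _ w.
  rewrite -!mulmxA -hom_mulmx; rewrite (mulmxA (h _) (q _)) (mulmxA (h _) (q _)).
  by rewrite !hq hom_mulmx.
by exists (@Hom _ _ _ N Y h hP).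
Qed.

Lemma hom_colift L M Y (f : hom L M) (g : hom Y M) : mono f ->
    (forall x (v : 'cV_(dim_vect Y x)), exists u, f x *m u = g x *m v) ->
  exists h : hom Y L, forall x, f x *m h x = g x.
Proof.
move=> monof fg.
have [B BP] := fin_all_exists (fun x => inj_mx_linv (monof x)).
pose h x := B x *m g x.
have fh x : f x *m h x = g x.
  apply: mulmx_cVP => v; have [u fu] := fg x v.
  by rewrite -!mulmxA -fu (mulmxA (B x)) BP mul1mx.
clearbody h.
have hP : intertwines (mod_rep Y) (mod_rep L) h.
  move=> a; apply: mulmx_cVP => v; apply/eqP; rewrite -subr_eq0; apply/eqP.
  apply: monof; rewrite mulmxBr -!mulmxA hom_mulmx !(mulmxA (f _) (h _)) !fh.
  by rewrite hom_mulmx subrr.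
by exists (@Hom _ _ _ Y L h hP).
Qed.

Lemma submodule_ker M N (f : hom M N) :
  submodule (fun x (v : 'cV_(dim_vect M x)) => f x *m v = 0).
Proof.
split=> [x|a u fu]; last by rewrite hom_mulmx fu mulmx0.
split=> [|u v fu fv|c u fu]; first by rewrite mulmx0.
  by rewrite mulmxDr fu fv addr0.
by rewrite -scalemxAr fu scaler0.
Qed.

Lemma submodule_im M N (f : hom M N) :
  submodule (fun x (w : 'cV_(dim_vect N x)) => exists v, f x *m v = w).
Proof.
split=> [x|a _ [v <-]]; last by exists (mod_rep M a *m v); rewrite hom_mulmx.
split=> [|_ _ [u <-] [v <-]|c _ [u <-]]; first by exists 0; rewrite mulmx0.
  by exists (u + v); rewrite mulmxDr.
by exists (c *: u); rewrite scalemxAr.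
Qed.

Lemma ex_image M N (f : hom M N) : exists Y (p : hom M Y) (i : hom Y N),
  [/\ epi p, mono i & forall x, i x *m p x = f x].
Proof.
have [Y [i [monoi iP]]] := ex_submodule (submodule_im f).
have [|p ip] := @hom_colift _ _ _ i f monoi.
  by move=> x v; apply/iP; exists v.
exists Y, p, i; split=> // x w.
have /iP[v fv] : exists u, i x *m u = i x *m w by exists w.
exists v; apply/eqP; rewrite -subr_eq0; apply/eqP/monoi.
by rewrite mulmxBr mulmxA ip fv subrr.
Qed.

Definition dim M := \sum_x dim_vect M x.

Lemma dim_eqP M N : (forall x, dim_vect M x <= dim_vect N x)%N ->
  (dim N <= dim M)%N -> forall x, dim_vect M x = dim_vect N x.
Proof.
move=> le leNM x; apply/eqP.
have [_] := leqif_sum (fun x (_ : true) =>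
  conj (le x) (erefl (dim_vect M x == dim_vect N x))).
by rewrite eqn_leq leNM leq_sum // => /esym/forallP/(_ x).
Qed.

Lemma epi_mono M N (f : hom M N) : epi f -> (dim M <= dim N)%N -> mono f.
Proof.
move=> epif le x; apply: surj_mx_inj (epif x).
by apply: dim_eqP => // y; exact: surj_mx_leq (epif y).
Qed.

Lemma mono_epi M N (f : hom M N) : mono f -> (dim N <= dim M)%N -> epi f.
Proof.
move=> monof le x; apply: inj_mx_surj (monof x).
by apply: esym; apply: dim_eqP => // y; exact: inj_mx_leq (monof y).
Qed.

Lemma iso_inv M N (f : hom M N) : mono f -> epi f ->
  exists g : hom N M, (forall x, f x *m g x = 1%:M) /\
    (forall x, g x *m f x = 1%:M).
Proof.
move=> monof epif; have [|g gP] := @hom_lift _ _ _ f (idhom M) epif.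
  by move=> x v /monof->; rewrite mulmx0.
exists g; split=> // x; apply: mulmx_cVP => w; have [v <-] := epif x w.
by rewrite -mulmxA (mulmxA (g x)) gP !mul1mx.
Qed.

End ModuleTheory.

(** * Generators, free modules and the radical *)

Section FreeModules.
Local Open Scope ring_scope.
Variables (k : closedFieldType) (Q : quiver) (I : path_alg k Q -> Prop).
Hypothesis hI : admissible I.
Implicit Types (L M N P : module I) (x y : vertex Q) (a : arrow Q).
Implicit Types r : vertex Q -> nat.

(** The generators at [x] are the [r x] columns of [E x]. *)
Definition generates P r (E : forall x, 'M[k]_(dim_vect P x, r x)) :=
  forall U, @submodule k Q I P U -> (forall x c, U x (E x *m c)) ->
  forall x w, U x w.

(** Sequences of more than [m] arrows act as zero, so each [P x] is spanned by the images of the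
    generators under the finitely many sequences of length at most [m]. *)
Lemma generates_bounded r : exists b,
  forall P (E : forall x, 'M_(dim_vect P x, r x)),
  generates E -> (dim P <= b)%N.
Proof.
have [_ [m _ mI] _] := hI.
pose T : finType := ({x & 'I_(r x)} * {bseq m of arrow Q})%type.
exists (\sum_(x : vertex Q) #|T|)%N => P E genE; apply: leq_sum => y _.
pose V := mod_rep P.
pose act (t : T) x : 'cV_(dim_vect P x) :=
  foldl (arrow_act V) (supp_at (col (tagged t.1) (E (tag t.1)))) t.2 x.
pose A x := \matrix_(i < #|T|) (act (enum_val i) x)^T.
have rowA t x : ((act t x)^T <= A x)%MS.
  by rewrite -[t]enum_rankK -(rowK (fun i => (act (enum_val i) x)^T)) row_sub.
suff AT x (w : 'cV_(dim_vect P x)) : (w^T <= A x)%MS.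
  have : (1%:M <= A y)%MS.
    by apply/row_subP => i; rewrite -[row i _]trmxK AT.
  move/mxrankS; rewrite mxrank1 => le; apply: leq_trans le _; exact: rank_leq_row.
apply: (genE (fun x (w : 'cV_(dim_vect P x)) => (w^T <= A x)%MS)) => {x w} [|x c].
  split=> [x|a u].
    split=> [|u v uA vA|c u uA]; first by rewrite trmx0 sub0mx.
      by rewrite linearD addmx_sub.
    by rewrite linearZ scalemx_sub.
  case/submxP => D uD; rewrite trmx_mul uD -mulmxA; apply: mulmx_sub.
  apply/row_subP => i; rewrite row_mul rowK -trmx_mul.
  move: (enum_val i) => [j s].
  have -> : mod_rep P a *m act (j, s) (src a) =
      foldl (arrow_act V) (supp_at (col (tagged j) (E (tag j)))) (rcons s a) (tgt a).
    by rewrite foldl_rcons /arrow_act supp_at_in.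
  have [lts|ges] := leqP (size (rcons s a)) m.
    exact: (rowA (j, Bseq lts)).
  rewrite (rep_nilpotent mI) ?trmx0 ?sub0mx //; first exact: mod_rep_variety.
  exact: ltnW.
rewrite trmx_mul; apply: mulmx_sub; apply/row_subP => i.
have := rowA (Tagged _ i, [bseq]) x; rewrite /act /= supp_at_in.
by rewrite tr_col.
Qed.

(** A submodule of [L] is tested through its image in [N]; injectivity of [f] brings the conclusion
    back. *)
Lemma generates_mono_image L N r (f : hom L N)
  (E : forall x, 'M_(dim_vect L x, r x)) :
  mono f ->
  (forall U, @submodule k Q I N U -> (forall x c, U x (f x *m (E x *m c))) ->
    forall x w, U x (f x *m w)) -> generates E.
Proof.
move=> monof fE U [Usub Ustab] UE x w.
pose fU x (v : 'cV_(dim_vect N x)) := exists2 u, U x u & f x *m u = v.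
have [||u Uu /eqP] := fE fU _ _ x w.
- split=> [z|a _ [u Uu <-]]; last first.
    by exists (mod_rep L a *m u); [exact: Ustab | rewrite hom_mulmx].
  have [U0 UD UZ] := Usub z.
  split=> [|_ _ [u Uu <-] [v Uv <-]|c _ [u Uu <-]].
  + by exists 0; rewrite ?mulmx0.
  + by exists (u + v); [exact: UD | rewrite mulmxDr].
  by exists (c *: u); [exact: UZ | rewrite scalemxAr].
- by move=> z c; exists (E z *m c).
rewrite -subr_eq0 -mulmxBr => /eqP/monof/eqP.
by rewrite subr_eq0 => /eqP <-.
Qed.

Lemma ex_generated N r (F : forall x, 'M[k]_(dim_vect N x, r x)) :
  exists L (f : hom L N) (E : forall x, 'M_(dim_vect L x, r x)),
    [/\ mono f, forall x, f x *m E x = F x & generates E].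
Proof.
(* The intersection of all submodules that contain the columns of [F]. *)
pose G x w := forall U, @submodule k Q I N U ->
  (forall x c, U x (F x *m c)) -> U x w.
have Gsub : submodule G.
  split=> [x|a u Gu U Usub UF]; last by apply: Usub.2; apply: Gu.
  split=> [|u v Gu Gv|c u Gu] U Usub UF; have [/(_ x)[U0 UD UZ] _] := Usub => //.
    by apply: UD; [apply: Gu | apply: Gv].
  by apply: UZ; apply: Gu.
have [L [f [monof fG]]] := ex_submodule Gsub.
have /fin_all_exists[E EF] x : exists E, f x *m E = F x.
  by apply: factor_mx => c; apply/fG => U _; apply.
exists L, f, E; split=> //; apply: (generates_mono_image monof) => U Usub UE x w.
have /fG : exists u, f x *m u = f x *m w by exists w.
by apply=> // y c; rewrite -EF -mulmxA.
Qed.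

Lemma generates_epi L P r (E : forall x, 'M_(dim_vect P x, r x)) (f : hom L P) :
  generates E -> (forall x (c : 'cV_(r x)), exists v, f x *m v = E x *m c) -> epi f.
Proof.
move=> genE fE x w.
exact: (genE (fun x (w : 'cV_(dim_vect P x)) => exists v, f x *m v = w))
         (submodule_im f) fE x w.
Qed.

Lemma generates_hom_ext P N r
  (E : forall x, 'M_(dim_vect P x, r x)) (f g : hom P N) :
  generates E ->
  (forall x, f x *m E x = g x *m E x) -> forall x, f x = g x.
Proof.
move=> genE fg x; apply: mulmx_cVP => w; apply/eqP; rewrite -subr_eq0 -mulmxBl.
apply/eqP; have := genE _ (submodule_ker (lincomb_hom (-1) g f)) _ x w.
rewrite /= scaleN1r (addrC (- _)); apply=> y c.
by rewrite scaleN1r (addrC (- _)) mulmxA mulmxBl fg subrr mul0mx.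
Qed.

(** The universal property of the projective module with [r x] summands belonging to the trivial
    path at [x]; for [r] constantly 1 this is the regular module. *)
Definition free_on P r (E : forall x, 'M[k]_(dim_vect P x, r x)) :=
  generates E /\
  forall N (F : forall x, 'M_(dim_vect N x, r x)),
    exists f : hom P N, forall x, f x *m E x = F x.

(* A generated module of maximal dimension is free: the submodule of [P + N]
   generated by the pairs [(E, F)] surjects onto [P], hence is the graph of a
   morphism. *)
Lemma ex_free r : exists P (E : forall x, 'M_(dim_vect P x, r x)), free_on E.
Proof.
have [b bP] := generates_bounded r.
(* The zero module ensures that the maximum below is taken over a nonempty set. *)
have zI : rep_variety I
    (fun a => 0 : 'M[k]_((fun=> 0%N) (tgt a), (fun=> 0%N) (src a))).
  by move=> f _ v x; rewrite [LHS]flatmx0.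
pose gendim n := exists P (E : forall x, 'M_(dim_vect P x, r x)),
  generates E /\ dim P = n.
have [||_ [[P [E [genE <-]]] maxP]] := @ex_nat_max gendim b.
- have [P [_ [E [_ _ genE]]]] := @ex_generated (Module zI) r (fun=> 0).
  by exists (dim P), P, E.
- by move=> _ [P [E [genE <-]]]; exact: bP genE.
exists P, E; split=> // N F.
have [S [i1 [i2 [p1 [p2 [p1i1 p2i2 p1i2 p2i1 _]]]]]] := ex_direct_sum P N.
have [L [f [G [monof fG genG]]]] :=
  @ex_generated S r (fun x => i1 x *m E x + i2 x *m F x).
have p1fG x : p1 x *m f x *m G x = E x.
  by rewrite -mulmxA fG mulmxDr !mulmxA p1i1 p1i2 mul1mx mul0mx addr0.
have p2fG x : p2 x *m f x *m G x = F x.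
  by rewrite -mulmxA fG mulmxDr !mulmxA p2i1 p2i2 mul1mx mul0mx add0r.
have epip : epi (comp_hom p1 f).
  by apply: (generates_epi genE) => x c; exists (G x *m c); rewrite /= mulmxA p1fG.
have monop : mono (comp_hom p1 f).
  by apply: epi_mono epip _; apply: maxP; exists L, G.
have [|h hP] := @hom_lift _ _ _ _ _ _ _ (comp_hom p2 f) epip.
  by move=> x v /monop->; rewrite mulmx0.
by exists h => x; rewrite -{1}p1fG mulmxA hP p2fG.
Qed.

(** One vector [w a] per arrow; [supp_at] discards the arrows that do not end at [x]. *)
Definition rad M x (v : 'cV[k]_(dim_vect M x)) :=
  exists w : forall a, 'cV_(dim_vect M (src a)),
    v = \sum_a supp_at (mod_rep M a *m w a) x.

Lemma rad_arrow M a u : rad (mod_rep M a *m u).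
Proof.
exists (@dfwith _ (fun b => 'cV[k]_(dim_vect M (src b))) (fun=> 0) a u).
rewrite (bigD1 a) //= dfwith_in supp_at_in big1 ?addr0 // => b neq.
by rewrite dfwith_out 1?eq_sym // mulmx0 supp_at0.
Qed.

Lemma submodule_rad M : submodule (@rad M).
Proof.
split=> [x|a u _]; last exact: rad_arrow.
split=> [|_ _ [u ->] [v ->]|c _ [u ->]].
- by exists (fun=> 0); rewrite big1 // => a _; rewrite mulmx0 supp_at0.
- exists (fun a => u a + v a); rewrite -big_split; apply: eq_bigr => a _ /=.
  by rewrite mulmxDr supp_atD.
exists (fun a => c *: u a); rewrite scaler_sumr; apply: eq_bigr => a _.
by rewrite -scalemxAr supp_atZ.
Qed.

(** Unfolding the hypothesis [m] times writes an element of [Z] as a sum of vectors reached through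
    [m] arrows, and these are zero. *)
Lemma nakayama M (Z : forall x, 'cV[k]_(dim_vect M x) -> Prop) :
    (forall x z, Z x z -> exists w, (forall a, Z (src a) (w a)) /\
       z = \sum_a supp_at (mod_rep M a *m w a) x) ->
  forall x z, Z x z -> z = 0.
Proof.
move=> ZP; have [_ [m _ mI] _] := hI.
pose V := mod_rep M.
(* Induction on a bound [n] for the number of arrows that [s] lacks to reach length [m]. *)
suff nil n s x (z : 'cV_(dim_vect M x)) y : (m - n <= size s)%N -> Z x z ->
    foldl (arrow_act V) (supp_at z) s y = 0.
  by move=> x z Zz; have := nil m [::] x z x; rewrite subnn /= supp_at_in; apply.
elim: n s x z y => [|n IH] s x z y les Zz.
  by rewrite (rep_nilpotent mI (@mod_rep_variety _ _ _ M)) // -[m]subn0.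
have [w [Zw ->]] := ZP _ _ Zz.
pose u a : rep_vect k (dim_vect M) := supp_at (supp_at (mod_rep M a *m w a) x).
rewrite (@foldl_arrow_act_ext _ _ _ _ _ _ (fun y => \sum_a u a y)); last first.
  by move=> t; rewrite supp_at_sum.
rewrite foldl_arrow_act_bigsum big1 // => a _; rewrite /u.
have [eqx|neq] := eqVneq (tgt a) x; last first.
  apply: foldl_arrow_act0 => t.
  by rewrite (supp_at_out (mod_rep M a *m w a)) // supp_at0.
(* The arrow [a] is moved from the vector to the front of [s]. *)
have := IH (a :: s) (src a) (w a) y; case: _ / eqx in z les Zz u *.
rewrite /= leq_subLR -addSnnS -leq_subLR => /(_ les (Zw a)) <-.
by apply: foldl_arrow_act_ext => t; rewrite /arrow_act !supp_at_in.
Qed.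


End FreeModules.

(** * Families of matrices as row vectors *)

Section Flattening.
Local Open Scope ring_scope.
Variables (k : fieldType) (V : finType).
Implicit Types d r : V -> nat.

(** Its cardinality is the dimension of the space of morphisms from a free module on [r] to a module
    with dimension vector [d]. *)
Definition entries d r : finType := {x : V & ('I_(d x) * 'I_(r x))%type}.

Definition flat d r (F : forall x, 'M[k]_(d x, r x)) : 'rV_#|entries d r| :=
  \row_i F (tag (enum_val i)) (tagged (enum_val i)).1 (tagged (enum_val i)).2.

Definition unflat d r (v : 'rV[k]_#|entries d r|) x : 'M_(d x, r x) :=
  \matrix_(i, j) v 0 (enum_rank (Tagged (fun x => 'I_(d x) * 'I_(r x))%type (i, j))).

Lemma flatK d r (F : forall x, 'M[k]_(d x, r x)) x : unflat (flat F) x = F x.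
Proof. by apply/matrixP => i j; rewrite !mxE enum_rankK. Qed.

Lemma unflatK d r (v : 'rV[k]_#|entries d r|) : flat (unflat v) = v.
Proof.
apply/rowP => i; rewrite !mxE; congr (v _ _); apply: (canLR enum_valK).
by case: (enum_val i) => x [].
Qed.

Lemma unflat_inj d r (u v : 'rV[k]_#|entries d r|) :
  (forall x, unflat u x = unflat v x) -> u = v.
Proof.
move=> uv; rewrite -(unflatK u) -(unflatK v); apply/rowP => i.
by rewrite mxE [RHS]mxE uv.
Qed.

Lemma unflat0 d r x : unflat (0 : 'rV[k]_#|entries d r|) x = 0.
Proof. by apply/matrixP => i j; rewrite !mxE. Qed.

Lemma unflat_mulmx n d r (u : 'rV[k]_n) (A : 'M_(n, #|entries d r|)) x :
  unflat (u *m A) x = \sum_i u 0 i *: unflat (row i A) x.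
Proof.
apply/matrixP => i j; rewrite !mxE summxE.
by apply: eq_bigr => l _; rewrite !mxE.
Qed.

Lemma flat_eq0 d r (F : forall x, 'M[k]_(d x, r x)) :
  flat F = 0 -> forall x, F x = 0.
Proof. by move=> F0 x; rewrite -flatK F0 unflat0. Qed.

End Flattening.

(** * Tops, weakly initial objects and split extensions *)

Section Presentations.
Local Open Scope ring_scope.
Variables (k : closedFieldType) (Q : quiver) (I : path_alg k Q -> Prop).
Hypothesis hI : admissible I.
Implicit Types (L M N P K X Y : module I) (x y : vertex Q) (a : arrow Q).
Implicit Types (r : vertex Q -> nat) (T : subcat I).

Lemma hom_rad M N (f : hom M N) (w : forall a, 'cV_(dim_vect M (src a))) x :
  f x *m (\sum_a supp_at (mod_rep M a *m w a) x) =
    \sum_a supp_at (mod_rep N a *m (f (src a) *m w a)) x.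
Proof.
rewrite mulmx_sumr; apply: eq_bigr => a _.
by rewrite mulmx_supp_at hom_mulmx.
Qed.

(** The vectors congruent to a combination of generators modulo the radical form a submodule, as
    arrows map into the radical. *)
Lemma generates_top P r (E : forall x, 'M_(dim_vect P x, r x)) :
  generates E -> forall x w, exists c, rad (w - E x *m c).
Proof.
move=> genE; apply: (genE (fun x w => exists c, rad (w - E x *m c))) => [|x c].
  split=> [x|a u _].
    have [/(_ x) [R0 RD RZ] _] := submodule_rad P.
    split=> [|u v [c cP] [d dP]|b u [c cP]].
    - by exists 0; rewrite mulmx0 subr0.
    - by exists (c + d); rewrite mulmxDr opprD addrACA; apply: RD.
    - by exists (b *: c); rewrite -scalemxAr -scalerBr; apply: RZ.
  by exists 0; rewrite mulmx0 subr0; apply: rad_arrow.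
by exists c; rewrite subrr; have [/(_ x) []] := submodule_rad P.
Qed.

(** [D] lifts a basis of the quotient of [M] by its radical. *)
Lemma ex_top M : exists r (D : forall x, 'M_(dim_vect M x, r x)),
  (forall x v, exists c, rad (v - D x *m c)) /\
  (forall x c, rad (D x *m c) -> c = 0).
Proof.
have [radS _] := submodule_rad M.
have [r rP] := fin_all_exists (fun x => subspace_kernel (radS x)).
have [C CP] := fin_all_exists rP.
have [D CD] := fin_all_exists (fun x => (CP x).1).
exists r, D; split=> x c.
  exists (C x *m c); apply/(CP x).2.
  by rewrite mulmxBr mulmxA CD mul1mx subrr.
by move/(CP x).2; rewrite mulmxA CD mul1mx.
Qed.

(** The point [c] amounts to a morphism from the regular module to [C]; the condition makes it a
    left [T]-approximation. *)
Definition weakly_initial T C (c : forall x, 'cV[k]_(dim_vect C x)) :=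
  T C /\ forall Y (y : forall x, 'cV_(dim_vect Y x)), T Y ->
    exists h : hom C Y, forall x, h x *m c x = y x.

Lemma ex_weakly_initial T : covariantly_finite T ->
  exists C (c : forall x, 'cV_(dim_vect C x)), weakly_initial T c.
Proof.
move=> covT; have [P [e [_ freeP]]] := ex_free hI (fun=> 1%N).
have [C [f [TC fP]]] := covT P.
exists C, (fun x => f x *m e x); split=> // Y y TY.
have [g gE] := freeP Y y; have [h hP] := fP Y g TY.
by exists h => x; rewrite mulmxA -hP gE.
Qed.

Lemma ex_min_weakly_initial T : covariantly_finite T ->
  exists C (c : forall x, 'cV_(dim_vect C x)), weakly_initial T c /\
    forall C' c', @weakly_initial T C' c' -> (dim C <= dim C')%N.
Proof.
move=> /ex_weakly_initial[C [c wiC]].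
pose widim n := exists C (c : forall x, 'cV_(dim_vect C x)),
  weakly_initial T c /\ dim C = n.
have [|_ [[C0 [c0 [wi0 <-]]] min0]] := @ex_nat_min widim.
  by exists (dim C), C, c.
by exists C0, c0; split=> // C' c' wi'; apply: min0; exists C', c'.
Qed.

(** The middle term lies in [T], so weak initiality gives [s] from [C] to [E] over a lift of [c].
    Then [p s] fixes [c], its image is again weakly initial, and minimality makes [p s]
    bijective. *)
Lemma min_weakly_initial_split T C (c : forall x, 'cV_(dim_vect C x)) :
    torsion_class T -> weakly_initial T c ->
    (forall C' c', @weakly_initial T C' c' -> (dim C <= dim C')%N) ->
  forall X E (f : hom X E) (p : hom E C), short_exact f p -> T X -> split_epi p.
Proof.
move=> [_ Tquot Text] [TC wiC] minC X E f p fp TX; have [_ epip _] := fp.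
have TE : T E by apply: Text fp TX TC.
have [e ec] := fin_all_exists (fun x => epip x (c x)).
have [s se] := wiC E e TE.
have [Y [q [i [epiq monoi iq]]]] := ex_image (comp_hom p s).
have iqc x : i x *m (q x *m c x) = c x by rewrite mulmxA iq /= -mulmxA se ec.
have wiY : weakly_initial T (fun x => q x *m c x).
  split=> [|Z z TZ]; first exact: Tquot epiq TC.
  have [h hz] := wiC Z z TZ.
  by exists (comp_hom h i) => x; rewrite /= -mulmxA iqc.
have leCY := minC _ _ wiY.
have epii := mono_epi monoi leCY; have monoq := epi_mono epiq leCY.
have [i' [ii' _]] := iso_inv monoi epii; have [q' [qq' _]] := iso_inv monoq epiq.
exists (comp_hom s (comp_hom q' i')) => x /=.
by rewrite !mulmxA -[p x *m s x]iq -(mulmxA (i x)) qq' mulmx1 ii'.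
Qed.

(* The pushout of [0 -> K -> P -> C -> 0] along [s] splits. *)
Lemma split_extension C K P X (i : hom K P) (p : hom P C) (s : hom K X) :
    short_exact i p ->
    (forall E (f : hom X E) (g : hom E C), short_exact f g -> split_epi g) ->
  exists t : hom P X, forall x, t x *m i x = s x.
Proof.
move=> [monoi epip ip] splitC.
have [S [i1 [i2 [p1 [p2 [p1i1 p2i2 p1i2 p2i1 idS]]]]]] := ex_direct_sum P X.
(* The cokernel of [i1 i - i2 s] is the pushout. *)
pose m : hom K S := lincomb_hom (-1) (comp_hom i2 s) (comp_hom i1 i).
have mE x : m x = i1 x *m i x - i2 x *m s x by rewrite /= scaleN1r addrC.
have [E [q [epiq qm]]] := ex_quotient (submodule_im m).
have pi0 x (u : 'cV_(dim_vect K x)) : p x *m (i x *m u) = 0 by apply/ip; exists u.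
have [|g gq] := @hom_lift _ _ _ _ _ _ q (comp_hom p p1) epiq.
  move=> x v /qm[u <-]; rewrite mE mulmxBl mulmxBr -!mulmxA.
  by rewrite !(mulmxA (p1 x)) p1i1 p1i2 mul1mx mul0mx pi0 mulmx0 subrr.
have qm0 x (u : 'cV_(dim_vect K x)) :
    q x *m (i1 x *m (i x *m u)) = q x *m (i2 x *m (s x *m u)).
  apply/eqP; rewrite -subr_eq0 -mulmxBr; apply/eqP/qm; exists u.
  by rewrite mE mulmxBl -!mulmxA.
pose j := comp_hom q i2.
have monoj : mono j.
  move=> x v; rewrite /= -mulmxA => /qm[u]; rewrite mE mulmxBl -!mulmxA => uv.
  have /monoi u0 : i x *m u = 0.
    have := congr1 (mulmx (p1 x)) uv; rewrite mulmxBr !mulmxA p1i1 p1i2.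
    by rewrite mul1mx !mul0mx subr0.
  have := congr1 (mulmx (p2 x)) uv; rewrite u0 !mulmx0 subrr mulmx0.
  by rewrite mulmxA p2i2 mul1mx.
have jg : short_exact j g.
  split=> // [x w|x v].
    have [v <-] := epip x w; exists (q x *m (i1 x *m v)).
    by rewrite mulmxA gq /= -mulmxA (mulmxA (p1 x)) p1i1 mul1mx.
  split=> [|[u <-]]; last first.
    by rewrite /= -mulmxA mulmxA gq /= -mulmxA (mulmxA (p1 x)) p1i2 mul0mx mulmx0.
  have [w <-] := epiq x v; rewrite mulmxA gq /= -mulmxA => /ip[u uP].
  exists (s x *m u + p2 x *m w); rewrite -mulmxA.
  rewrite -[w in RHS]mul1mx -idS mulmxDl -!mulmxA -uP !mulmxDr; congr (_ + _).
  by rewrite qm0.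
have [sg gsg] := splitC _ _ _ jg.
(* The endomorphism [1 - sg g] lands in the kernel of [g], the image of [j]; factoring it through
   [j] gives a retraction [t]. *)
have [|t jt] := @hom_colift _ _ _ _ _ _ j
  (lincomb_hom (-1) (comp_hom sg g) (idhom E)) monoj.
  move=> x v; have [_ _ /(_ x) jgx] := jg; apply/jgx.
  by rewrite /= scaleN1r mulmxA mulmxDr mulmxN mulmx1 mulmxA gsg mul1mx addNr mul0mx.
exists (comp_hom t (comp_hom q i1)) => x; apply: mulmx_cVP => u.
have gqi0 : g x *m (q x *m (i1 x *m (i x *m u))) = 0.
  by rewrite (mulmxA (g x)) gq /= -mulmxA (mulmxA (p1 x)) p1i1 mul1mx pi0.
apply/eqP; rewrite -subr_eq0; apply/eqP/monoj; rewrite mulmxBr /= -!mulmxA.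
rewrite mulmxA (mulmxA _ (t x)) -[_ *m t x]/(j x *m t x) jt /=.
rewrite mulmxDl mul1mx scaleN1r mulNmx -mulmxA gqi0 mulmx0 oppr0 add0r.
by rewrite qm0 subrr.
Qed.

End Presentations.

(** * Counting morphisms through a presentation *)

Section Counting.
Local Open Scope ring_scope.
Variables (k : closedFieldType) (Q : quiver) (I : path_alg k Q -> Prop).
Hypothesis hI : admissible I.
Implicit Types (L M N P K X Y : module I) (x y : vertex Q) (a : arrow Q).
Implicit Types (r : vertex Q -> nat) (T : subcat I).

(** The image of [f] coincides with its own radical, so [nakayama] applies. *)
Lemma mulmx_top_eq0 K N r (D : forall x, 'M_(dim_vect K x, r x)) (f : hom K N) :
    (forall x v, exists c, rad (v - D x *m c)) ->
    (forall x, f x *m D x = 0) -> forall x, f x = 0.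
Proof.
move=> topD fD x; apply: mulmx_cVP => v; rewrite mul0mx.
apply: (nakayama hI (Z := fun x z => exists v, z = f x *m v)); last by exists v.
move=> {v}x _ [v ->]; have [c [w wP]] := topD x v.
exists (fun a => f (src a) *m w a); split=> [a|]; first by exists (w a).
by rewrite -hom_rad -wP mulmxBr mulmxA fD mul0mx subr0.
Qed.

Lemma top_cover_epi P K r (E : forall x, 'M_(dim_vect P x, r x))
    (D : forall x, 'M_(dim_vect K x, r x)) (p : hom P K) :
    (forall x v, exists c, rad (v - D x *m c)) ->
    (forall x, p x *m E x = D x) -> epi p.
Proof.
move=> topD pE; have [Y [q [epiq qp]]] := ex_quotient (submodule_im p).
move=> x w; apply/qp; rewrite (mulmx_top_eq0 topD) ?mul0mx // => y.
apply: mulmx_cVP => c; rewrite mul0mx -mulmxA; apply/qp; exists (E y *m c).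
by rewrite mulmxA pE.
Qed.

(* The map [h' = h - g i p] below sends [P1] into [h' (ker p)], while [ker p] lies
   in the radical of [P1]; hence [h'] vanishes by nilpotency. *)
Lemma presentation_onto M C K P0 P1 r0 r1
    (E0 : forall x, 'M_(dim_vect P0 x, r0 x))
    (E1 : forall x, 'M_(dim_vect P1 x, r1 x))
    (D : forall x, 'M_(dim_vect K x, r1 x))
    (i : hom K P0) (q : hom P0 C) (p : hom P1 K) :
    free_on E0 -> generates E1 -> short_exact i q ->
    (forall x v, exists c, rad (v - D x *m c)) ->
    (forall x c, rad (D x *m c) -> c = 0) ->
    (forall x, p x *m E1 x = D x) ->
    (forall X (f : hom M X), epi f -> forall E (j : hom X E) (g : hom E C),
       short_exact j g -> split_epi g) ->
  forall h : hom P1 M, exists g : hom P0 M, forall x, g x *m i x *m p x = h x.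
Proof.
move=> [gen0 free0] gen1 iq topD indD pE splitC h.
have epip : epi p := top_cover_epi topD pE.
have [L [l [monol lP]]] := ex_submodule (submodule_ker p).
have pl0 x (u : 'cV_(dim_vect L x)) : p x *m (l x *m u) = 0 by apply/lP; exists u.
(* Modulo the radical, [u] is some [E1 c]; then [D c] is in the radical of [K], and independence of
   the top forces [c = 0]. *)
have rad_ker x u : p x *m u = 0 -> rad u.
  move=> pu; have [c cP] := generates_top gen1 u.
  have [/(_ x) [_ radD radZ] _] := submodule_rad K.
  have c0 : c = 0.
    apply: indD; have [w wP] := cP.
    have : rad (p x *m (u - E1 x *m c)).
      by rewrite wP hom_rad; exists (fun a => p (src a) *m w a).
    rewrite mulmxBr pu sub0r mulmxA pE => /(radZ (-1)).
    by rewrite scaleN1r opprK.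
  by move: cP; rewrite c0 mulmx0 subr0.
(* Modulo [h (ker p)] the map [h] descends to [K], extends to [P0] by splitting, and lifts back to
   [M] by freeness. *)
have [X [f [epif fP]]] := ex_quotient (submodule_im (comp_hom h l)).
have [|s sp] := @hom_lift _ _ _ _ _ _ p (comp_hom f h) epip.
  move=> x v /lP[u <-]; rewrite /= -mulmxA; apply/fP; exists u.
  by rewrite /= mulmxA.
have [t ti] := split_extension s iq (splitC X f epif).
have /fin_all_exists[F FP] x : exists F, f x *m F = t x *m E0 x.
  by apply: factor_mx => c; apply: epif.
have [g gE] := free0 M F; exists g => x.
have fg y : f y *m g y = t y.
  apply: (generates_hom_ext (f := comp_hom f g) gen0) => z /=.
  by rewrite -mulmxA gE FP.
pose h' : hom P1 M := lincomb_hom (-1) (comp_hom g (comp_hom i p)) h.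
have h'E y : h' y = h y - g y *m (i y *m p y) by rewrite /= scaleN1r addrC.
suff h'0 : h' x = 0.
  by apply/esym/eqP; rewrite -subr_eq0 -mulmxA -h'E h'0.
apply: mulmx_cVP => v; rewrite mul0mx.
apply: (nakayama hI (Z := fun x z => exists v, z = h' x *m v)); last by exists v.
move=> {v} {}x _ [v ->].
have /fP[u /= uP] : f x *m (h' x *m v) = 0.
  rewrite h'E mulmxBl mulmxBr !mulmxA fg -[f x *m h x]/(comp_hom f h x) -sp ti.
  by rewrite subrr.
have vE : h' x *m v = h' x *m (l x *m u).
  rewrite -uP -mulmxA [in RHS]h'E mulmxBl -!mulmxA.
  by rewrite pl0 !mulmx0 subr0.
have [w wP] := rad_ker _ _ (pl0 x u).
exists (fun a => h' (src a) *m w a); split=> [a|]; first by exists (w a).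
by rewrite vE wP hom_rad.
Qed.

Lemma ex_lincomb_hom n M N (f : 'I_n -> hom M N) (u : 'rV[k]_n) :
  exists g : hom M N, forall x, g x = \sum_i u 0 i *: f i x.
Proof.
have gP : intertwines (mod_rep M) (mod_rep N) (fun x => \sum_i u 0 i *: f i x).
  move=> a; rewrite mulmx_suml mulmx_sumr; apply: eq_bigr => i _.
  by rewrite -scalemxAl -scalemxAr hom_intertwines.
by exists (@Hom _ _ _ M N _ gP).
Qed.

(** Row [i] of [A] is the value on [R] of the morphism given on generators by the [i]-th elementary
    family; freeness makes every morphism a combination of these. *)
Lemma evaluation_mx N P r0 r1 (E : forall x, 'M_(dim_vect P x, r0 x))
    (R : forall x, 'M_(dim_vect P x, r1 x)) : free_on E ->
  exists A, forall f : hom P N,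
    flat (fun x => f x *m R x) = flat (fun x => f x *m E x) *m A.
Proof.
move=> [genE freeE].
have [f fE] := fin_all_exists (fun i => freeE N (unflat (delta_mx 0 i))).
exists (\matrix_i flat (fun x => f i x *m R x)) => g.
set u := flat (fun x => g x *m E x).
have [h hE] := ex_lincomb_hom f u.
have gh : forall x, g x = h x.
  apply: (generates_hom_ext genE) => x; rewrite hE mulmx_suml.
  rewrite -(flatK (fun x => g x *m E x)) -/u -[u in LHS]mulmx1 unflat_mulmx.
  by apply: eq_bigr => i _; rewrite rowE mulmx1 -scalemxAl fE.
apply: unflat_inj => x; rewrite flatK unflat_mulmx gh hE mulmx_suml.
by apply: eq_bigr => i _; rewrite rowK flatK scalemxAl.
Qed.

Lemma free_hom_eq0 N P r (E : forall x, 'M_(dim_vect P x, r x)) (f : hom P N) :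
  generates E -> (forall x, f x *m E x = 0) -> forall x, f x = 0.
Proof.
move=> genE fE; apply: (generates_hom_ext (g := zero_hom P N) genE) => x.
by rewrite fE mul0mx.
Qed.

(** The evaluation matrix is onto, and [f] gives a nonzero element of its kernel. *)
Lemma relations_lt M P r0 r1 (E : forall x, 'M_(dim_vect P x, r0 x))
    (R : forall x, 'M_(dim_vect P x, r1 x)) (f : hom P M) : free_on E ->
    (forall F : forall x, 'M_(dim_vect M x, r1 x),
       exists g : hom P M, forall x, g x *m R x = F x) ->
    (exists x, f x != 0) -> (forall x, f x *m R x = 0) ->
  (#|entries (dim_vect M) r1| < #|entries (dim_vect M) r0|)%N.
Proof.
move=> freeE onto [x fx] fR; have [A AP] := evaluation_mx M R freeE.
have fullA : row_full A.
  rewrite -sub1mx; apply/row_subP => j; have [g gR] := onto (unflat (row j 1%:M)).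
  apply/submxP; exists (flat (fun x => g x *m E x)); rewrite -AP.
  by apply: unflat_inj => y; rewrite flatK gR.
rewrite ltn_neqAle -{2}(eqP fullA) rank_leq_row andbT; apply/negP => /eqP eqn.
have freeA : row_free A by rewrite /row_free (eqP fullA) eqn.
case/eqP: fx; apply: (free_hom_eq0 freeE.1) => {}x; move: x.
apply: flat_eq0.
apply: (row_free_inj freeA); rewrite -AP mul0mx.
by apply: unflat_inj => y; rewrite flatK fR unflat0.
Qed.

(** A homogeneous system with more unknowns than equations has a nonzero solution. *)
Lemma relations_lt_hom N P r0 r1 (E : forall x, 'M_(dim_vect P x, r0 x))
    (R : forall x, 'M_(dim_vect P x, r1 x)) : free_on E ->
    (#|entries (dim_vect N) r1| < #|entries (dim_vect N) r0|)%N ->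
  exists f : hom P N, (exists x, f x != 0) /\ forall x, f x *m R x = 0.
Proof.
move=> freeE lt; have [A AP] := evaluation_mx N R freeE.
have [[u [uA u0]]|nu] := classic (exists u : 'rV_#|entries (dim_vect N) r0|,
  u *m A = 0 /\ u != 0).
  have [f fE] := freeE.2 N (unflat u).
  have fu : flat (fun x => f x *m E x) = u.
    by apply: unflat_inj => x; rewrite flatK fE.
  exists f; split=> [|x]; last first.
    rewrite -(flatK (fun x => f x *m R x)) AP fu uA; exact: unflat0.
  apply: NNPP => nf; case/eqP: u0; rewrite -fu.
  apply: unflat_inj => x; rewrite flatK unflat0.
  have [->|fx] := eqVneq (f x) 0; first by rewrite mul0mx.
  by case: nf; exists x.
have : row_free A.
  apply: inj_row_free => u uA; apply/eqP/negPn/negP => u0.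
  by case: nu; exists u.
by move/eqP=> rkA; move: lt; rewrite -rkA ltnNge rank_leq_col.
Qed.

Lemma ex_hom_same_dim T C (c : forall x, 'cV_(dim_vect C x)) M N :
    torsion_class T -> weakly_initial T c ->
    (forall C' (c' : forall x, 'cV_(dim_vect C' x)),
      weakly_initial T c' -> (dim C <= dim C')%N) ->
    T M -> (exists x, (1%:M : 'M[k]_(dim_vect M x)) != 0) ->
    dim_vect N = dim_vect M ->
  exists f : hom C N, exists x, f x != 0.
Proof.
move=> torsT wiC minC TM [z M0] eqNM.
have [P0 [E0 free0]] := ex_free hI (dim_vect C).
have [q qE] := free0.2 C (fun=> 1%:M).
have epiq : epi q by move=> x w; exists (E0 x *m w); rewrite mulmxA qE mul1mx.
have [K [i [monoi iP]]] := ex_submodule (submodule_ker q).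
have iq : short_exact i q by split.
have [r1 [D [topD indD]]] := ex_top K.
have [P1 [E1 free1]] := ex_free hI r1.
have [p pE] := free1.2 K D.
pose R x := i x *m D x.
have [w w0] : exists w : 'cV[k]_(dim_vect M z), w != 0.
  apply: NNPP => nw; case/eqP: M0; apply: mulmx_cVP => v.
  rewrite mul1mx mul0mx; apply/eqP/negPn/negP => v0.
  by case: nw; exists v.
(* A nonzero morphism from [C] to [M], since it sends [c] to a nonzero vector. *)
have [g gc] := wiC.2 M (supp_at w) TM.
have qi0 x : q x *m i x = 0.
  by apply: mulmx_cVP => v; rewrite mul0mx -mulmxA; apply/iP; exists v.
have lt : (#|entries (dim_vect M) r1| < #|entries (dim_vect M) (dim_vect C)|)%N.
  apply: (relations_lt (R := R) (f := comp_hom g q) free0).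
  - move=> F; have [h hF] := free1.2 M F.
    have [|f fh] := presentation_onto free0 free1.1 iq topD indD pE _ h.
      move=> X f epif E j s js; apply: (min_weakly_initial_split torsT wiC minC js).
      by case: torsT => _ quot _; exact: quot epif TM.
    by exists f => x; rewrite -hF -fh -!mulmxA pE.
  - exists z; apply: contraNneq w0 => gq0; rewrite -[w]supp_at_in -gc.
    by have [v <-] := epiq z (c z); rewrite mulmxA [g z *m q z]gq0 mul0mx.
  by move=> x; rewrite /R /= -mulmxA (mulmxA (q x)) qi0 mul0mx mulmx0.
rewrite -eqNM in lt; have [f [[x fx] fR]] := relations_lt_hom R free0 lt.
(* Vanishing on the lifted top [D] is vanishing on all of [K], so [f] descends to [C]. *)
have fi0 : forall x, f x *m i x = 0.
  by apply: (mulmx_top_eq0 (f := comp_hom f i) topD) => y; rewrite /= -mulmxA fR.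
have [|h hq] := @hom_lift _ _ _ _ _ _ q f epiq.
  by move=> y v /iP[u <-]; rewrite mulmxA fi0 mul0mx.
exists h, x; apply: contraNneq fx => h0.
by rewrite -hq h0 mul0mx.
Qed.

End Counting.

(** * The open condition that there are no nonzero morphisms from a fixed representation *)

Section Openness.
Local Open Scope ring_scope.
Variables (k : closedFieldType) (Q : quiver) (d e : vertex Q -> nat).
Variable C : rep_space k e.
Implicit Types (V : rep_space k d) (h : forall x, 'M[k]_(d x, e x)).

Let hom_defect V h (a : arrow Q) : 'M[k]_(d (tgt a), e (src a)) :=
  h (tgt a) *m C a - V a *m h (src a).

Let defect_mx V : 'M_(#|entries d e|, #|entries (d \o @tgt Q) (e \o @src Q)|) :=
  \matrix_i flat (hom_defect V (unflat (delta_mx 0 i))).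

Let mul_defect_mx V u : u *m defect_mx V = flat (hom_defect V (unflat u)).
Proof.
apply: unflat_inj => a; rewrite unflat_mulmx flatK /hom_defect.
have uE x : unflat u x = \sum_i u 0 i *: unflat (delta_mx 0 i) x.
  by rewrite -{1}[u]mulmx1 unflat_mulmx; apply: eq_bigr => i _; rewrite rowE mulmx1.
rewrite !uE mulmx_suml mulmx_sumr -sumrB; apply: eq_bigr => i _.
by rewrite rowK flatK -scalemxAl -scalemxAr -scalerBr.
Qed.

(** The matrix [defect_mx] with indeterminates in place of the coordinates of [V]. *)
Let defect_poly :
    'M[{mpoly k[#|coord_index d|]}]_(#|entries d e|,
      #|entries (d \o @tgt Q) (e \o @src Q)|) :=
  \matrix_(i, j) (let a := tag (enum_val j) in
    let p := (tagged (enum_val j)).1 in let q := (tagged (enum_val j)).2 in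
    \sum_l (unflat (delta_mx 0 i) (tgt a) p l * C a l q)%:MP
    - \sum_l 'X_(enum_rank
        (Tagged (fun a => 'I_(d (tgt a)) * 'I_(d (src a)))%type (p, l)))
             * (unflat (delta_mx 0 i) (src a) l q)%:MP).

Let eval_defect_poly V :
  map_mx (meval (fun i => coord V (enum_val i))) defect_poly = defect_mx V.
Proof.
apply/matrixP => i j; rewrite !mxE rmorphB !rmorph_sum /=.
congr (_ - _); apply: eq_bigr => l _; first by rewrite mevalC.
by rewrite mevalM mevalC mevalXU enum_rankK.
Qed.

Lemma no_hom_open :
  zariski_open (fun V => forall h, intertwines C V h -> forall x, h x = 0).
Proof.
set O := fun V => _.
(* All polynomials vanishing off [O]; each point of [O] must then be detected by one of them. *)
exists (fun P => forall V, ~ O V -> P.@[fun i => coord V (enum_val i)] = 0).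
move=> V0; split=> [nOV0 P|vanV0 OV0]; first exact.
(* With [B] a right inverse at [V0], the polynomial [det (defect_mx V *m B)] is 1 at [V0]; where it
   is nonzero, [defect_mx V] is injective and [V] lies in [O]. *)
have /row_freeP[B AB] : row_free (defect_mx V0).
  apply: inj_row_free => u; rewrite mul_defect_mx => /flat_eq0 u0.
  apply: unflat_inj => x; rewrite unflat0; apply: OV0 => a.
  by apply/eqP; rewrite -subr_eq0; apply/eqP/u0.
have evalP V :
    (\det (defect_poly *m map_mx (@mpolyC _ k) B)).@[fun i => coord V (enum_val i)]
    = \det (defect_mx V *m B).
  rewrite -det_map_mx map_mxM eval_defect_poly; congr (\det (_ *m _)).
  by apply/matrixP => i j; rewrite !mxE /= mevalC.
have := vanV0 (\det (defect_poly *m map_mx (@mpolyC _ k) B)).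
rewrite evalP AB det1 => /(_ _)/eqP; rewrite oner_eq0 => /(_ _)/notF; apply.
move=> V nOV; rewrite evalP; apply/eqP/negPn/negP => detn0; apply: nOV => h hP.
apply: flat_eq0; apply: (row_free_inj (A := defect_mx V *m B)).
  by rewrite row_free_unit unitmxE unitfE.
rewrite mul0mx mulmxA mul_defect_mx.
suff -> : flat (hom_defect V (unflat (flat h))) = 0 by rewrite mul0mx.
apply: unflat_inj => a; rewrite flatK unflat0 /hom_defect !flatK.
by rewrite hP subrr.
Qed.

End Openness.

(** * Torsion classes cut out by vanishing of morphisms *)

Section Bricks.
Local Open Scope ring_scope.
Variables (k : closedFieldType) (Q : quiver) (I : path_alg k Q -> Prop).
Implicit Types (M N Y : module I) (T : subcat I).

Lemma torsion_class_hom_orthogonal T N : torsion_class T ->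
  torsion_class (fun M => T M /\ forall f : hom M N, forall x, f x = 0).
Proof.
case=> [[M0 TM0] Tquot Text];
  split=> [|M Y f epif [TM MN]|L M Y f g fg [TL LN] [TY YN]].
(* [Z] is the zero module, as the quotient of [M0] by itself. *)
- have [Z [q [epiq qP]]] := ex_quotient (submodule_im (idhom M0)).
  exists Z; split=> [|f x]; first exact: Tquot epiq TM0.
  apply: mulmx_cVP => w; have [v <-] := epiq x w.
  by rewrite (qP x v).2 ?mulmx0 //; exists v; rewrite mul1mx.
- split=> [|h x]; first exact: Tquot epif TM.
  apply: mulmx_cVP => w; have [v <-] := epif x w.
  by rewrite mulmxA [h x *m _](MN (comp_hom h f)) !mul0mx.
split=> [|h]; first exact: Text fg TL TY.
have [monof epig ker] := fg.
have [|h' h'g] := @hom_lift _ _ _ _ _ _ g h epig.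
  move=> x v /ker[u <-].
  by rewrite mulmxA [h x *m _](LN (comp_hom h f)) mul0mx.
by move=> x; rewrite -h'g YN mul0mx.
Qed.

(** Otherwise the modules of [T'] without nonzero morphisms to [Y] form an intermediate torsion
    class: [M] separates it from [T], and [Y], through its identity, from [T']. *)
Lemma torsion_cover_hom T T' M Y : torsion_cover T T' -> T' M -> ~ T M -> T' Y ->
    (exists x (v : 'cV[k]_(dim_vect Y x)), v != 0) ->
    (forall X (f : hom X Y), T X -> forall x, f x = 0) ->
  exists f : hom M Y, exists x, f x != 0.
Proof.
case=> [_ torsT' [leTT' _] cover] T'M nTM T'Y [x [v v0]] TY.
apply: NNPP => nf; apply: (cover _ (torsion_class_hom_orthogonal Y torsT')).
have MY (f : hom M Y) y : f y = 0.
  by apply/eqP/negPn/negP => f0; case: nf; exists f, y.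
split; split.
- by move=> X TX; split=> [|f]; [exact: leTT' | exact: TY].
- by move/(_ M (conj T'M MY)).
- by move=> X [].
case/(_ Y T'Y) => _ /(_ (idhom Y) x) /= id0; case/eqP: v0.
  by rewrite -[v]mul1mx id0 mul0mx.
Qed.

End Bricks.

(** * Orbits of minimal extending bricks *)

Theorem theorem1p5 (k : closedFieldType) (Q : quiver)
    (I : path_alg k Q -> Prop)
    (hQ : connected_quiver Q) (hI : admissible I)
    (M : module I) (hM : minimal_extending_brick M) :
  open_in (@rep_variety k Q (dim_vect M) I) (GL_orbit (mod_rep M)).
Proof.
have [T [T' [[[_ covT] [_ covT'] cover [M0 _] T'M] [TM quotM _]]]] := hM.
have [torsT torsT' _ _] := cover.
have [C [c [TC wiC]]] := ex_weakly_initial hI covT.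
exists (fun V => forall h, intertwines (mod_rep C) V h -> forall x, h x = 0%R).
  exact: no_hom_open.
move=> V; split=> [[g unitg Vg]|[VI OV]].
  (* On the orbit, [g] transports the relations from [M] to [V], and its inverse carries morphisms
     from [C] to [V] back to [M]. *)
  have gP : intertwines (mod_rep M) V g by move=> a; rewrite Vg mulmxKV.
  split=> [|h hP x].
    apply: (rep_variety_epi gP) (@mod_rep_variety _ _ _ M) => x w.
    by exists (invmx (g x) *m w)%R; rewrite mulKVmx.
  have ghP : intertwines (mod_rep C) (mod_rep M) (fun x => invmx (g x) *m h x)%R.
    move=> a; rewrite -mulmxA hP mulmxA -[V a](mulmxK (unitg (src a))) -gP.
    by rewrite !mulmxA mulVmx // mul1mx.
  have /(_ x) /= gh0 := TM _ (@Hom _ _ _ C M _ ghP) TC.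
  by rewrite -[h x](mulKVmx (unitg x)) gh0 mulmx0.
pose N := Module VI.
(* Every vector of [X] is hit by a morphism from [C], whose composite with [f] vanishes. *)
have TN X (f : hom X N) : T X -> forall x, f x = 0%R.
  move=> TX x; apply: mulmx_cVP => v; rewrite mul0mx.
  have [h hc] := wiC X (supp_at v) TX.
  rewrite -[v]supp_at_in -hc mulmxA.
  by rewrite [(_ *m h x)%R](OV _ (hom_intertwines (comp_hom f h))) mul0mx.
have [C' [c' [wiC' minC']]] := ex_min_weakly_initial hI covT'.
have [f [x fx]] := ex_hom_same_dim hI (N := N) torsT' wiC' minC' T'M M0 erefl.
have [Y [p [i [epip monoi ip]]]] := ex_image f.
have [_ quot' _] := torsT'.
have T'Y : T' Y by apply: quot' epip _; case: wiC'.
have nTM : ~ T M.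
  case: M0 => y M0 /(TM _ (idhom M))/(_ y) /= id0; case/eqP: M0; exact: id0.
have [|X g TX y|g [y gy]] := torsion_cover_hom cover T'M nTM T'Y.
- exists x; apply: NNPP => nv; case/eqP: fx; apply: mulmx_cVP => v.
  rewrite -ip -mulmxA mul0mx.
  have [->|pv] := eqVneq (p x *m v)%R 0%R; first by rewrite mulmx0.
  by case: nv; exists (p x *m v)%R.
- apply: mulmx_cVP => v; rewrite mul0mx; apply: monoi.
  by rewrite mulmxA [(_ *m g y)%R](TN _ (comp_hom i g) TX) mul0mx.
pose ig : hom M N := comp_hom i g.
have monog : mono ig.
  (* Were it not injective, its image would be a proper quotient of [M], hence in [T], and would map
     to [N] only by zero. *)
  apply: NNPP => nmono.
  have [Z [q [j [epiq monoj jq]]]] := ex_image ig.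
  have TZ : T Z.
    apply: (quotM Z q epiq) => monoq; apply: nmono => z v.
    by rewrite -jq -mulmxA => /monoj/monoq.
  case/eqP: gy; apply: mulmx_cVP => v; rewrite mul0mx; apply: monoi.
  by rewrite mulmxA -[(i y *m g y)%R]jq (TN _ j TZ) !mul0mx.
(* [N] has the dimension vector of [M] by construction, so these injective matrices are square. *)
have unitg z : ig z \in unitmx.
  have [B BA] := inj_mx_linv (monog z).
  exact: (@mulmx1_unit k (dim_vect M z) B (ig z) BA).2.
exists ig => [z|a]; first exact: unitg.
by rewrite (hom_intertwines ig) (mulmxK (unitg (src a))).
Qed.
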